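(* Let $P\subset\mathbb{C}$ be an open half-plane such that $0\in\partial P$, and write points as $x+iy$ with $x,y\in\mathbb{R}$. (1) If $P$ is described either by $y>ax$ or by $y<ax$, with $a\in\mathbb{R}$, then $\iota(P)$ is the open half-plane described by $y<-ax$ or $y>-ax$, respectively. (2) If $P$ is described either by $x>0$ or by $x<0$, then $\iota(P)=P$.
   Context: $\overline{\mathbb{C}}=\mathbb{C}\cup\{\infty\}$ is the Riemann sphere and $\iota:\overline{\mathbb{C}}\to\overline{\mathbb{C}}$ is the inversion $\iota(z)=z^{-1}$ with $\iota(0)=\infty$ and $\iota(\infty)=0$. $\partial P$ is the boundary of $P$ in $\mathbb{C}$. *)

(* Defs.v *)
From HB Require Import structures.
From mathcomp Require Export all_boot all_order all_algebra.
From mathcomp Require Export complex.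
From mathcomp Require Export mathcomp_extra boolp classical_sets reals.
From mathcomp Require Export topology normedtype.

Set Implicit Arguments.
Unset Strict Implicit.
Unset Printing Implicit Defensive.

Export Order.TTheory GRing.Theory Num.Theory.
Export numFieldNormedType.Exports.

Local Open Scope classical_set_scope.
Local Open Scope ring_scope.
Local Open Scope complex_scope.

(* The norm topology of a [numFieldType] is not inferred on [R[i]] by
   unification, hence the explicit copy. *)
HB.instance Definition _ (R : realType) :=
  PseudoMetricNormedZmod.copy R[i] (R[i] : numFieldType)^o.

Definition riemann_sphere (R : realType) : Type :=
  one_point_compactification R[i].

Definition sphere_of (R : realType) (z : R[i]) : riemann_sphere R := Some z.

Definition sphere_infty (R : realType) : riemann_sphere R := None.

Definition inversion (R : realType) (w : riemann_sphere R) : riemann_sphere R :=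
  match w with
  | Some z => if z == 0 then sphere_infty R else sphere_of z^-1
  | None => sphere_of 0
  end.

Definition boundary (T : topologicalType) (A : set T) : set T :=
  closure A `\` interior A.

(* [complex.Re] and [complex.Im] take values in [R], whereas ['Re] and ['Im]
   take values in [R[i]]. *)
Definition open_half_plane (R : realType) (P : set R[i]) : Prop :=
  exists a b c : R, (a, b) != (0, 0) /\
    P = [set z : R[i] | c < a * complex.Re z + b * complex.Im z].

(* Main.v *)
Require Import Defs.
From mathcomp Require Import lra.

(** Since [1/(x + iy) = (x - iy)/(x^2 + y^2)], the form [p x - q y] evaluated
    at [1/z] is a positive multiple of [p x + q y] evaluated at [z]; so inversion
    exchanges the half-planes where these two forms are positive. *)

Local Open Scope classical_set_scope.
Local Open Scope ring_scope.
Local Open Scope complex_scope.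

(** One family covers all four shapes: slanted half-planes have [q] equal to [1] or [- 1], vertical
    ones have [q = 0]. *)
Definition positive_half_plane {R : realType} (p q : R) : set R[i] :=
  [set z | 0 < p * complex.Re z + q * complex.Im z].

(** The form vanishes at the origin and the inequality is strict. Hence [inversion] acts on such a
    set as the field inverse and never reaches infinity. *)
Lemma positive_half_plane_neq0 {R : realType} (p q : R) (z : R[i]) :
  positive_half_plane p q z -> z != 0.
Proof.
move=> Az; apply/eqP => z0; move: Az.
by rewrite z0 /positive_half_plane /= !mulr0 addr0 ltxx.
Qed.

Lemma positive_half_planeV {R : realType} (p q : R) (z : R[i]) :
  positive_half_plane p q z -> positive_half_plane p (- q) z^-1.
Proof.
move=> Az; have := positive_half_plane_neq0 _ _ _ Az; move: Az.
case: z => x y; rewrite /positive_half_plane /= => Az.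
rewrite eq_complex /= negb_and => xy0.
have N0 : 0 < x ^+ 2 + y ^+ 2.
  rewrite lt0r paddr_eq0 ?sqr_ge0 // !sqrf_eq0 negb_and xy0.
  by rewrite addr_ge0 ?sqr_ge0.
(* The sign of [- q] cancels the one that inversion puts on the imaginary part. *)
rewrite (_ : _ + _ = (p * x + q * y) / (x ^+ 2 + y ^+ 2)) ?divr_gt0 //.
by rewrite mulrNN !mulrA -mulrDl.
Qed.

Lemma inversion_positive_half_plane {R : realType} (p q : R) :
  @inversion R @` (@sphere_of R @` positive_half_plane p q) =
  @sphere_of R @` positive_half_plane p (- q).
Proof.
have inv_sphere (s : R) (z : R[i]) : positive_half_plane p s z ->
    inversion (sphere_of z) = sphere_of z^-1.
  by move=> /positive_half_plane_neq0 /negPf z0; rewrite /inversion /sphere_of z0.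
apply/seteqP; split => [_ [_ [z Az <-] <-]|_ [w Qw <-]].
  rewrite (inv_sphere _ _ Az).
  by exists z^-1 => //; exact: positive_half_planeV.
(* Both [z^-1] and the sign change of [q] are involutive, so the same lemma at [- q] shows that
   [w^-1] is a preimage in the original half-plane. *)
have Aw := positive_half_planeV _ _ _ Qw; rewrite opprK in Aw.
by exists (sphere_of w^-1); [exists w^-1 | rewrite (inv_sphere _ _ Aw) invrK].
Qed.

Lemma open_positive_half_plane {R : realType} (p q : R) :
  (p, q) != (0, 0) -> open_half_plane (positive_half_plane p q).
Proof. by exists p, q, 0. Qed.

Theorem theorem12 (R : realType) (P : set R[i])
    (halfP : open_half_plane P) (bndP : boundary P (0 : R[i])) :
  (forall a : R,
     (P = [set z : R[i] | complex.Im z > a * complex.Re z] ->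
        let Q := [set z : R[i] | complex.Im z < - a * complex.Re z] in
        open_half_plane Q /\
        @inversion R @` (@sphere_of R @` P) = @sphere_of R @` Q) /\
     (P = [set z : R[i] | complex.Im z < a * complex.Re z] ->
        let Q := [set z : R[i] | complex.Im z > - a * complex.Re z] in
        open_half_plane Q /\
        @inversion R @` (@sphere_of R @` P) = @sphere_of R @` Q)) /\
  (P = [set z : R[i] | complex.Re z > 0] \/
   P = [set z : R[i] | complex.Re z < 0] ->
     @inversion R @` (@sphere_of R @` P) = @sphere_of R @` P).
Proof.
have above (a : R) : [set z : R[i] | complex.Im z > a * complex.Re z] =
    positive_half_plane (- a) 1.
  by apply/seteqP; split => z; rewrite /positive_half_plane /=; lra.
have below (a : R) : [set z : R[i] | complex.Im z < a * complex.Re z] =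
    positive_half_plane a (- 1).
  by apply/seteqP; split => z; rewrite /positive_half_plane /=; lra.
have right : [set z : R[i] | complex.Re z > 0] = positive_half_plane 1 0.
  by apply/seteqP; split => z; rewrite /positive_half_plane /=; lra.
have left : [set z : R[i] | complex.Re z < 0] = positive_half_plane (- 1) 0.
  by apply/seteqP; split => z; rewrite /positive_half_plane /=; lra.
split=> [a|[->|->]]; last 2 first.
(* Here [q = 0] is its own opposite, so the half-plane is mapped to itself. *)
- by rewrite right inversion_positive_half_plane oppr0.
- by rewrite left inversion_positive_half_plane oppr0.
(* The pair [(- a, 1)] goes to [(- a, - 1)], which is [below] at slope [- a]; the pair [(a, - 1)]
   goes to [(a, 1)], which is [above] at slope [- a]. *)
split=> -> /=; rewrite above below inversion_positive_half_plane ?opprK; split=> //.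
- by apply: open_positive_half_plane; rewrite xpair_eqE !oppr_eq0 oner_eq0 andbF.
- by apply: open_positive_half_plane; rewrite xpair_eqE oner_eq0 andbF.
Qed.
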